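(* Let $F$ be an arbitrary (commutative) field, let $d\geq 3$ be an integer, let $V$ be the $d$-dimensional vector space over $F$, and let $L=\mathrm{Sub}(V)$ be the lattice of all subspaces of $V$. Let $t:=f^{\mathrm{mng}}(F)$ be the minimum of the cardinalities of the generating sets of the field $F$. Then $$4\leq f^{\mathrm{mng}}(L)\leq 4+\Bigl\lceil \frac{t}{\lfloor d^2/4\rfloor}\Bigr\rceil .$$
   Context: For a lattice or a field $A$, $f^{\mathrm{mng}}(A):=\min\{|X| : X \text{ is a generating set of } A\}$, a (finite or infinite) cardinal number. A lattice is generated by $X$ if no proper sublattice (subset closed under binary joins and meets) contains $X$; a field is generated by $X$ if no proper subfield contains $X$ (so $f^{\mathrm{mng}}(F)=0$ if and only if $F$ is a prime field). The subspace lattice is ordered by inclusion. $\lfloor x\rfloor$ is the lower integer part of a real number. For a cardinal $t$ and a positive integer $n$, $\lceil t/n\rceil:=\min\{m : m \text{ is a cardinal and } mn\geq t\}$. *)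

(* Defs.v *)
From HB Require Import structures.
From mathcomp Require Import all_boot all_order all_algebra.
From mathcomp Require Import boolp classical_sets functions cardinality.

Set Implicit Arguments.
Unset Strict Implicit.
Unset Printing Implicit Defensive.

Import Order.TTheory GRing.Theory.

Local Open Scope classical_set_scope.
Local Open Scope card_scope.

(* A cardinal number is represented by any type of that cardinality: the      *)
(* natural number [n] by ['I_n], sums and products of cardinals by [+] and    *)
(* [*] on types, and [#|X|] by the type of elements of [X] ([set_type X]).    *)
(* All notions below are invariant under bijection.                           *)
Definition cardinal_le (c c' : Type) : Prop :=
  [set: c] #<= [set: c'].

Definition is_cardinal_min (P : Type -> Prop) (c : Type) : Prop :=
  P c /\ forall c', P c' -> cardinal_le c c'.

(* The least cardinal satisfying [P]. Cardinals being well-ordered, it exists *)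
(* as soon as [P] is satisfiable (cf. [cardinal_min_ex] and [mngP]); the      *)
(* default value [void] is not used then.                                     *)
Definition cardinal_min (P : Type -> Prop) : Type :=
  if pselect (exists c, is_cardinal_min P c) is left ex then projT1 (cid ex)
  else void.

Lemma cardinal_minP (P : Type -> Prop) :
  (exists c, is_cardinal_min P c) -> is_cardinal_min P (cardinal_min P).
Proof.
by move=> ex; rewrite /cardinal_min; case: pselect => // ex'; case: (cid ex').
Qed.

Lemma set_family_min (I T : Type) (A : I -> set T) : inhabited I ->
  exists i, forall j, A i #<= A j.
Proof.
move=> [i0].
pose P (S : set (I -> T)) := (forall g, S g -> forall i, A i (g i)) /\
  (forall g h, S g -> S h -> forall i, g i = h i -> g = h).
have [F FP tot|S [[SA Sinj] Smax]] := @Zorn_bigcup _ P.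
  split=> [g [X FX Xg]|g h [X FX Xg] [Y FY Yh]]; first exact: (FP X FX).1.
  have [XY|YX] := tot X Y FX FY.
    by apply: (FP Y FY).2 => //; exact: XY.
  by apply: (FP X FX).2 => //; exact: YX.
have [i hi] : exists i, forall a, A i a -> exists2 g, S g & g i = a.
  apply: contrapT => /forallNP ex.
  have /choice[h hP] i : exists a, A i a /\ forall g, S g -> g i <> a.
    have /existsNP[a /not_implyP[Aa Na]] := ex i.
    by exists a; split=> // g Sg ga; apply: Na; exists g.
  apply: (Smax (S `|` [set h])).
    split; first by move=> g Sg; left.
    by move=> sub; have := sub h (or_intror erefl); move=> /(hP i0).2 /(_ erefl).
  split=> [g [/SA//|->] i|g k]; first by case: (hP i).
  move=> [Sg|->] [Sk|->] i gk //; first exact: Sinj gk.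
  - by have := (hP i).2 g Sg gk.
  - by have := (hP i).2 k Sk; rewrite gk => /(_ erefl).
exists i => j; have /choice[f fP] (a : T) : exists b, A i a -> exists2 g, S g & g i = a /\ g j = b.
  have [Aa|nA] := pselect (A i a); last by exists a => /nA.
  by have [g Sg ga] := hi a Aa; exists (g j) => _; exists g.
have : $|{injfun (A i) >-> (A j)}|.
  apply/injfunPex; exists f => [a Aa|a b /set_mem Aa /set_mem Ab fab].
    by have [g Sg [_ <-]] := fP a Aa; exact: SA.
  have [g Sg [ga gfa]] := fP a Aa; have [h Sh [hb hfb]] := fP b Ab.
  by rewrite -ga -hb (Sinj g h Sg Sh j) // gfa hfb.
by move=> [k]; exact: inj_card_le.
Qed.

Lemma cardinal_min_ex (P : Type -> Prop) :
    (forall c c', cardinal_le c c' -> cardinal_le c' c -> P c -> P c') ->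
  (exists c, P c) -> is_cardinal_min P (cardinal_min P).
Proof.
move=> Peq [c0 Pc0]; apply: cardinal_minP.
have le_set T U (X : set T) (Y : set U) : cardinal_le X Y <-> X #<= Y.
  by rewrite /cardinal_le (card_le_eql (card_setT X)) (card_le_eqr (card_setT Y)).
have PT : P [set: c0] by apply: Peq Pc0; rewrite /cardinal_le ?(card_le_eql (card_setT _)) ?(card_le_eqr (card_setT _)).
have [[X PX] Xmin] :=
  @set_family_min {X : set c0 | P X} c0 sval (inhabits (exist _ _ PT)).
have minX (Y : set c0) : P Y -> cardinal_le X Y.
  by move=> PY; apply/le_set; exact: Xmin (exist _ _ PY).
exists X; split=> // c Pc.
have [inlT inrT] : range (@inl c0 c) #= [set: c0] /\ range (@inr c0 c) #= [set: c].
  by split; apply: inj_card_eq => x y _ _ [].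
have [b bmin] := @set_family_min bool (c0 + c)
  (fun b => if b then range inl else range inr) (inhabits true).
case: b bmin => [/(_ false)|/(_ true)].
  rewrite (card_le_eql inlT) (card_le_eqr inrT) => le_c.
  by rewrite /cardinal_le (card_le_eql (card_setT X)); exact: card_le_trans (card_leT X) le_c.
rewrite (card_le_eql inrT) (card_le_eqr inlT) => /card_leP[f].
have fI : {in [set: c] &, injective (fun x => val (f (to_setT x)))}.
  move=> x y _ _ /val_inj fxy.
  by have /(congr1 val) := 'inj_f (mem_set I) (mem_set I) fxy.
have fE := inj_card_eq fI; set Y := _ @` _ in fE.
have YE : [set: Y] #= [set: c] by rewrite (card_eql (card_setT Y)).
have [Yc cY] := (card_eqPle _ _).1 YE.
exact: card_le_trans (minX Y (Peq _ _ cY Yc Pc)) Yc.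
Qed.

(* [min {|X| : X generates}] *)
Definition mng (T : Type) (generates : set T -> Prop) : Type :=
  cardinal_min (fun c => exists2 X : set T, generates X & c = set_type X).

Lemma mngP (T : Type) (G : set T -> Prop) : (exists X, G X) ->
  is_cardinal_min (fun c => exists2 X : set T, G X & c = set_type X) (mng G).
Proof.
move=> [X0 GX0]; apply: cardinal_minP.
have [[X GX] XP] := @set_family_min {X | G X} T sval (inhabits (exist _ X0 GX0)).
exists (set_type X); split; first by exists X.
move=> _ [Y GY ->]; have := XP (exist _ Y GY) => /=.
by rewrite /cardinal_le (card_le_eql (card_setT X)) (card_le_eqr (card_setT Y)).
Qed.

Definition cardinal_ceil_div (t : Type) (n : nat) : Type :=
  cardinal_min (fun m => cardinal_le t (m * 'I_n)).

Definition generates_lattice (disp : Order.disp_t) (L : latticeType disp)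
    (X : set L) : Prop :=
  forall S : {pred L}, meet_closed S -> join_closed S ->
    {subset X <= S} -> S =i predT.

Definition generates_field (F : fieldType) (X : set F) : Prop :=
  forall K : {pred F}, GRing.divring_closed K -> {subset X <= K} -> K =i predT.

Definition mng_lattice (disp : Order.disp_t) (L : latticeType disp) : Type :=
  mng (@generates_lattice disp L).

Definition mng_field (F : fieldType) : Type := mng (@generates_field F).

(* [{vspace V}] ordered by inclusion, with [:&:] as meet and [+] as join. *)
Definition SubV (F : fieldType) (V : vectType F) : Type := {vspace V}.

Fact Sub_display : Order.disp_t. Proof. exact: Order.Disp tt tt. Qed.

Section SubspaceLattice.
Variables (F : fieldType) (V : vectType F).
Implicit Types U W X : {vspace V}.

HB.instance Definition _ := Choice.on (SubV V).

Fact Sub_le_anti : antisymmetric (fun U W => (U <= W)%VS).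
Proof. by move=> U W /subv_anti. Qed.

Fact Sub_le_trans : transitive (fun U W => (U <= W)%VS).
Proof. by move=> W U X; apply: subv_trans. Qed.

HB.instance Definition _ := Order.Le_isPOrder.Build Sub_display (SubV V)
  (@subvv _ V) Sub_le_anti Sub_le_trans.

HB.instance Definition _ := Order.POrder_MeetJoin_isLattice.Build
  Sub_display (SubV V) (@subv_cap _ V) (@subv_add _ V).

End SubspaceLattice.

(* Main.v *)
Require Import Defs.
From HB Require Import structures.
From mathcomp Require Import all_boot all_order all_algebra.
From mathcomp Require Import boolp classical_sets functions cardinality.
From mathcomp Require Import zify.

(* Lower bound. The endomorphisms of [V] stabilizing a subspace of dimension  *)
(* [a] form a space of codimension at most [a (d - a) <= d^2 / 4], so those   *)
(* stabilizing three given subspaces form a space of dimension at least       *)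
(* [d^2 / 4 > 1]. A non-scalar [f] among them leaves some line non-invariant, *)
(* and the [f]-invariant subspaces are a proper sublattice.                   *)
(*                                                                            *)
(* Upper bound. Let [e_0, ..., e_(d-1)] be a basis. The spans of the [e_i]    *)
(* and of the [e_i - e_(i+1)], for [i] of a given parity, are four subspaces. *)
(* Shifting along the zigzag [e_0, e_1, ...] shrinks the spans of the [e_i]   *)
(* from either end, which isolates the lines [<e_i>] and then the lines       *)
(* [<e_i - e_(i+1)>]. Von Neumann's coordinatization then makes the set of    *)
(* [c] with [<e_i - c e_j>] in the sublattice a subfield independent of       *)
(* [i <> j], and the sublattice is everything once this subfield is [F]. One  *)
(* further subspace, the graph of a matrix from the even to the odd           *)
(* coordinates, puts its [floor (d^2 / 4)] entries in the subfield.           *)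

Set Implicit Arguments.
Unset Strict Implicit.
Unset Printing Implicit Defensive.

Import GRing.Theory.

Local Open Scope ring_scope.

(** Three subspaces never generate: a dimension count over their stabilizers ([stable_vspace],
    [common_stable]) gives a non-scalar endomorphism preserving all three, and its invariant
    subspaces form a proper sublattice ([no_three_generators]).

    For the upper bound, the four spans of axes and zigzag edges yield every axis ([bvec_mem]) and
    every line [pline V i i.+1 1] ([pline_succ_mem]). Over such a frame, [line_mem] cuts new lines
    out of sums of known ones, so the scalars reached form a subfield ([coefs_divring_closed]); once
    it is all of [F], every subspace is reached ([vspace_mem]). A graph subspace puts [d ^ 2 %/ 4]
    prescribed scalars into that subfield ([coefv_mem]), so the generators of [F] can be packed as
    entries of [cardinal_ceil_div t (d ^ 2 %/ 4)] matrices. *)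

(** * Lines, coordinates and the lines that encode scalars *)

Section Lines.
Variables (F : fieldType) (V : vectType F).
Implicit Types (a p x : V) (U W : {vspace V}).

Lemma cap_line a p (s : F) W : p \in W -> a \notin W ->
  ((<[a]> + <[p + s *: a]>) :&: W = <[p]>)%VS.
Proof.
move=> pW aW; apply/eqP; rewrite eqEsubv; apply/andP; split; last first.
  rewrite -memvE memv_cap pW andbT -[X in X \in _](addrK (s *: a)) addrC.
  by rewrite memv_add ?memv_line // -scaleNr memvZ ?memv_line.
apply/subvP => x; rewrite memv_cap => /andP[/memv_addP[_ /vlineP[k ->]]].
move=> [_ /vlineP[l ->] ->]; rewrite scalerDr scalerA addrCA -scalerDl => xW.
suff -> : k + l * s = 0 by rewrite scale0r addr0 memvZ ?memv_line.
apply: contraNeq aW => kls; rewrite -[a](scalerK kls); apply: memvZ.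
by rewrite -[X in X \in _](addKr (l *: p)) memvD // memvN memvZ.
Qed.

Lemma notin_lker (f : 'Hom(V, F^o)) W a :
  (W <= lker f)%VS -> f a != 0 -> a \notin W.
Proof. by move=> /subvP Wf; apply: contraNN => /Wf; rewrite memv_ker. Qed.

Lemma vlineZ (k : F) x : k != 0 -> (<[k *: x]> = <[x]>)%VS.
Proof.
move=> k0; apply/eqP; rewrite eqEsubv -!memvE memvZ ?memv_line //=.
by apply/vlineP; exists k^-1; rewrite scalerK.
Qed.

Definition bvec i : V := (vbasis {:V})`_i.

(** Total in [i] and zero past the dimension, so that a neighbour such as [i.+1] may fall off the
    basis. *)
Definition bcoord i : 'Hom(V, F^o) :=
  if insub i is Some k then linfun (coord (vbasis {:V}) k : V -> F^o) else 0.

Lemma bcoord_bvec i j :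
  bcoord i (bvec j) = ((i == j) && (i < \dim {:V})%N)%:R.
Proof.
rewrite /bcoord /bvec; case: insubP => [k _ <-|/negPf->]; last first.
  by rewrite andbF zero_lfunE.
rewrite ltn_ord andbT lfunE /=; have [lt_j|le_j] := ltnP j (\dim {:V}).
  by rewrite (coord_free (Ordinal lt_j) k) ?(basis_free (vbasisP _)) // eq_sym.
rewrite nth_default ?size_tuple // linear0.
by case: eqP (ltn_ord k) => // ->; rewrite ltnNge le_j.
Qed.

Lemma bcoord_eq i : (i < \dim {:V})%N -> bcoord i (bvec i) = 1.
Proof. by move=> id; rewrite bcoord_bvec eqxx id. Qed.

Lemma bcoord_neq i j : i != j -> bcoord i (bvec j) = 0.
Proof. by move=> /negPf ij; rewrite bcoord_bvec ij. Qed.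

Lemma bcoord_sum x : x = \sum_(i < \dim {:V}) bcoord i x *: bvec i.
Proof.
rewrite [LHS](coord_vbasis (memvf x)); apply: eq_bigr => i _.
by rewrite /bcoord valK lfunE.
Qed.

Lemma bcoordZ i (k : F) x : bcoord i (k *: x) = k * (bcoord i x : F).
Proof. exact: linearZ. Qed.

Lemma bcoord_eq0 x : (forall i, (i < \dim {:V})%N -> bcoord i x = 0) -> x = 0.
Proof.
by move=> x0; rewrite (bcoord_sum x) big1 // => i _; rewrite x0 ?scale0r.
Qed.

Lemma bcoordB i x y :
  bcoord i (x - y) = (bcoord i x : F) - (bcoord i y : F).
Proof. exact: linearB. Qed.

Lemma bcoordD i x y :
  bcoord i (x + y) = (bcoord i x : F) + (bcoord i y : F).
Proof. exact: linearD. Qed.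

(** Von Neumann's encoding of the scalar [c] in the plane of two axes. *)
Definition pline i j (c : F) : {vspace V} := <[bvec i - c *: bvec j]>%VS.

End Lines.

(** * Coordinatization of a sublattice that contains a frame *)

Section Frame.
Variables (F : fieldType) (V : vectType F) (S : {pred {vspace V}}).
Local Notation d := (\dim {:V}).
Local Notation e := (@bvec F V).
Local Notation co := (@bcoord F V).
Hypotheses (capS : {in S &, forall U W, (U :&: W)%VS \in S})
  (addS : {in S &, forall U W, (U + W)%VS \in S}).

(** Projection from the line of [a] onto [W]; the functional [f] certifies that [a] lies outside
    [W]. *)
Lemma line_mem (f : 'Hom(V, F^o)) a p (s : F) W :
    (W <= lker f)%VS -> f a != 0 -> p \in W ->
    <[a]>%VS \in S -> <[p + s *: a]>%VS \in S -> W \in S ->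
  <[p]>%VS \in S.
Proof.
move=> Wf fa pW aS pS WS; rewrite -(@cap_line _ _ a p s W) ?(notin_lker Wf) //.
by rewrite capS ?addS.
Qed.

Hypotheses (d_ge3 : (2 < d)%N) (eS : forall i, (i < d)%N -> <[e i]>%VS \in S).

(** Since [e i - a *: e j] equals [(e i - (a * b) *: e k) - a *: (e j - b *: e k)], projecting it
    from the second line into the plane of [e i] and [e k] gives the product. *)
Lemma pline_mul i j k a b :
    (i < d)%N -> (j < d)%N -> (k < d)%N -> i != j -> j != k ->
  pline V i j a \in S -> pline V j k b \in S -> pline V i k (a * b) \in S.
Proof.
move=> id jd kd ij jk iS jS.
apply: (@line_mem (co j) (e j - b *: e k) _ (- a) (<[e i]> + <[e k]>)%VS) => //.
- by rewrite subv_add -!memvE !memv_ker !bcoord_neq ?eqxx // eq_sym.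
- by rewrite bcoordB bcoordZ bcoord_eq // bcoord_neq // mulr0 subr0 oner_eq0.
- by rewrite memv_add ?memv_line // -scaleNr memvZ ?memv_line.
- congr (<[_]>%VS \in S): iS.
  by rewrite scaleNr scalerBr scalerA opprB subrKA.
- by rewrite addS ?eS.
Qed.

Hypothesis succS : forall i, (i.+1 < d)%N -> pline V i i.+1 1 \in S.

Lemma pline1 i j : (i < d)%N -> (j < d)%N -> i != j -> pline V i j 1 \in S.
Proof.
have sym k l : pline V k l 1 = pline V l k 1.
  rewrite /pline !scale1r.
  rewrite -(@vlineZ _ _ (-1) (e k - e l)) ?oppr_eq0 ?oner_eq0 //.
  by rewrite scaleN1r opprB.
have pos k : forall l, (l + k.+1 < d)%N -> pline V l (l + k.+1) 1 \in S.
  elim: k => [|k IHk] l ld; first by rewrite addn1 succS; lia.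
  rewrite -[1]mulr1 -(addSnnS l) .
  apply: (@pline_mul l l.+1) => //; try lia; first by apply: succS; lia.
  by apply: IHk; lia.
move=> id jd; rewrite neq_ltn => /orP[ij|ji].
  by have := pos (j - i.+1)%N i; rewrite (_ : i + _ = j)%N; [apply|lia].
rewrite sym; have := pos (i - j.+1)%N j.
by rewrite (_ : j + _ = i)%N; [apply|lia].
Qed.

Lemma pline_move i j k l a : (i < d)%N -> (j < d)%N -> (k < d)%N -> (l < d)%N ->
  i != j -> k != l -> pline V i j a \in S -> pline V k l a \in S.
Proof.
have mover i' j' l' : (i' < d)%N -> (j' < d)%N -> (l' < d)%N ->
    i' != j' -> i' != l' -> pline V i' j' a \in S -> pline V i' l' a \in S.
  move=> id jd ld ij il iS; have [<-//|jl] := eqVneq j' l'.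
  by rewrite -[a]mulr1; apply: pline_mul iS _ => //; apply: pline1.
have movel i' j' k' : (i' < d)%N -> (j' < d)%N -> (k' < d)%N ->
    i' != j' -> k' != j' -> pline V i' j' a \in S -> pline V k' j' a \in S.
  move=> id jd kd ij kj iS; have [<-//|ik] := eqVneq i' k'.
  rewrite -[a]mul1r; apply: pline_mul iS => //; first by rewrite eq_sym.
  by apply: pline1; rewrite // eq_sym.
move=> id jd kd ld ij kl iS.
have [il|il] := eqVneq i l; last first.
  by apply: (movel i) => //; apply: (mover i j).
(* The right end cannot move to [l = i] while the left end is [i]; the detour runs through (m, j),
   (m, l), (k, l). *)
have [m [md mi mj]] : exists m, [/\ (m < d)%N, m != i & m != j].
  case: (eqVneq 0%N i) => [i0|]; case: (eqVneq 0%N j) => [j0|];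
    case: (eqVneq 1%N i) => [i1|]; case: (eqVneq 1%N j) => [j1|] *;
    first [by exists 0%N; split; lia | by exists 1%N; split; lia
          | by exists 2%N; split; lia].
apply: (movel m) => //; first by rewrite -il.
apply: (mover m j) => //; first by rewrite -il.
by apply: (movel i).
Qed.

Lemma pline_sub i j a b : (i < d)%N -> (j < d)%N -> i != j ->
  pline V i j a \in S -> pline V i j b \in S -> pline V i j (a - b) \in S.
Proof.
move=> id jd ij aS bS.
have [k [kd ki kj]] : exists k, [/\ (k < d)%N, k != i & k != j].
  case: (eqVneq 0%N i) => [i0|]; case: (eqVneq 0%N j) => [j0|];
    case: (eqVneq 1%N i) => [i1|]; case: (eqVneq 1%N j) => [j1|] *;
    first [by exists 0%N; split; lia | by exists 1%N; split; lia
          | by exists 2%N; split; lia].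
have [ik jk] : i != k /\ j != k by rewrite !(eq_sym _ k).
have {}bS : pline V k j b \in S by apply: (pline_move _ _ _ _ _ _ bS).
(* This vector is the difference of [e i - a *: e j] and [e k - b *: e j]; projecting it from [e k]
   then leaves [e i - (a - b) *: e j]. *)
have qS : <[e i - e k - (a - b) *: e j]>%VS \in S.
  apply: (@line_mem (co i + co k) (e k - b *: e j) _ 1
    (<[e i - e k]> + <[e j]>)%VS) => //.
  - rewrite subv_add -!memvE !memv_ker !add_lfunE !bcoordB !bcoord_eq //.
    by rewrite !bcoord_neq ?subr0 ?sub0r ?addrN ?addr0 ?eqxx.
  - rewrite add_lfunE !bcoordB !bcoordZ bcoord_eq // !bcoord_neq //.
    by rewrite !mulr0 !subr0 add0r oner_eq0.
  - by rewrite memv_add ?memv_line // -scaleNr memvZ ?memv_line.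
  - congr (<[_]>%VS \in S): aS; rewrite scale1r scalerBl opprB.
    by rewrite addrACA subrK addrAC subrr sub0r.
  - rewrite addS ?eS //; have := pline1 id kd ik.
    by rewrite /pline scale1r.
apply: (@line_mem (co k) (e k) _ (-1) (<[e i]> + <[e j]>)%VS).
- by rewrite subv_add -!memvE !memv_ker !bcoord_neq ?eqxx.
- by rewrite bcoord_eq ?oner_eq0.
- by rewrite memv_add ?memv_line // -scaleNr memvZ ?memv_line.
- exact: eS.
- by congr (<[_]>%VS \in S): qS; rewrite scaleN1r addrAC.
- by rewrite addS ?eS.
Qed.

Lemma pline_inv i j a : a != 0 -> pline V i j a = pline V j i a^-1.
Proof.
move=> a0; rewrite /pline -(@vlineZ _ _ (- a) (e j - _)) ?oppr_eq0 //.
by rewrite scalerBr scalerA mulNr mulfV // !scaleNr opprK scale1r addrC.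
Qed.

Lemma coefs_divring_closed :
  GRing.divring_closed [pred c | pline V 0 1 c \in S].
Proof.
have [d0 d1 d2] : [/\ 0 < d, 1 < d & 2 < d]%N by split; lia.
split=> [|a b|a b]; rewrite !inE; first exact: pline1.
  exact: pline_sub.
(* Here [a / 0] is 0, and its line is the axis of [e 0]. *)
have [->|b0] := eqVneq b 0.
  by rewrite invr0 mulr0 /pline scale0r subr0 eS.
rewrite (pline_inv _ _ b0) => aS bS.
apply: (@pline_move 0 2) => //; apply: (@pline_mul 0 1) => //.
exact: (@pline_move 1 0).
Qed.

Hypothesis coefS : forall c, pline V 0 1 c \in S.

Lemma vspace0_mem : 0%VS \in S.
Proof.
have -> : (0 = <[e 0]> :&: <[e 1]> :> {vspace V})%VS.
  apply/eqP; rewrite eqEsubv sub0v; apply/subvP => y.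
  rewrite memv_cap => /andP[/vlineP[k ->]] /vlineP[l] /(congr1 (co 0)).
  rewrite !bcoordZ bcoord_eq ?bcoord_neq //; last by lia.
  by rewrite mulr1 mulr0 => ->; rewrite scale0r mem0v.
by rewrite capS // eS; lia.
Qed.

(* Induction on the number of leading coordinates of [x]: when [x] has        *)
(* coordinates [b != 0] and [c] at [j] and [k], it spans the meet of the sum  *)
(* of [<x - c e_k>] and [<e_k>] with the sum of [<x - c e_k - b e_j>] and     *)
(* [<b e_j + c e_k>].                                                         *)
Lemma vline_mem x : <[x]>%VS \in S.
Proof.
suff H k : (k <= d)%N -> forall y, (forall i, (k <= i < d)%N -> co i y = 0) ->
    <[y]>%VS \in S.
  by apply: (H d) => // i /andP[di id]; move: id; rewrite ltnNge di.
elim: k => [_|k IHk kd] {}x x0.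
  rewrite (_ : x = 0); last by apply: bcoord_eq0 => i id; apply: x0.
  suff -> : <[0]>%VS = 0%VS :> {vspace V} by exact: vspace0_mem.
  by apply/eqP; rewrite -subv0 -memvE mem0v.
set c : F := co k x; pose y := x - c *: e k.
have y0 i : (k <= i < d)%N -> co i y = 0.
  move=> /andP[ki id]; rewrite bcoordB bcoordZ.
  have [->|ik] := eqVneq i k; first by rewrite bcoord_eq // mulr1 subrr.
  by rewrite bcoord_neq // mulr0 subr0 x0 // id andbT ltn_neqAle eq_sym ik.
have yS : <[y]>%VS \in S by apply: IHk => //; exact: ltnW.
have [c0|c0] := eqVneq c 0; first by rewrite /y c0 scale0r subr0 in yS.
have [/existsP[[j /= jk] bn0]|/existsPn y_0] :=
  boolP [exists i : 'I_k, co i y != 0]; last first.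
  suff /eqP : y = 0 by rewrite subr_eq0 => /eqP->; rewrite vlineZ ?eS.
  apply: bcoord_eq0 => i id; have [ki|ik] := leqP k i; first by rewrite y0 ?ki.
  by have := y_0 (Ordinal ik); rewrite negbK => /eqP.
set b : F := co j y in bn0; have jd := ltn_trans jk kd.
have [jnk knj] : j != k :> nat /\ k != j by rewrite !neq_ltn jk orbT.
pose z := y - b *: e j.
have z0 i : (k <= i < d)%N || (i == j) -> co i z = 0.
  rewrite bcoordB bcoordZ; case: eqVneq => [-> _|ij]; last first.
    by rewrite orbF => ikd; rewrite y0 // bcoord_neq // mulr0 subr0.
  by rewrite bcoord_eq // mulr1 subrr.
apply: (@line_mem (b *: co k - c *: co j) (e k) _ (- c)
  (<[z]> + <[b *: e j + c *: e k]>)%VS).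
- rewrite subv_add -!memvE !memv_ker !add_lfunE !opp_lfunE !scale_lfunE.
  rewrite !z0 ?eqxx ?orbT ?leqnn ?kd // !scaler0 subrr eqxx /=.
  rewrite !bcoordD !bcoordZ !bcoord_eq // !bcoord_neq // !mulr0 !mulr1.
  by rewrite addr0 add0r /GRing.scale /= mulrC subrr.
- rewrite add_lfunE opp_lfunE !scale_lfunE bcoord_eq // bcoord_neq //.
  by rewrite scaler0 subr0 /GRing.scale /= mulr1.
- have -> : x = z + (b *: e j + c *: e k) by rewrite addrA !subrK.
  by rewrite memv_add ?memv_line.
- exact: eS.
- by rewrite scaleNr.
apply: addS; first by apply: IHk (ltnW kd) _ _ => i ikd; rewrite z0 ?ikd.
have -> : b *: e j + c *: e k = b *: (e j - (- (c / b)) *: e k).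
  by rewrite scaleNr opprK scalerDr scalerA mulrC divfK.
by rewrite vlineZ //; apply: (@pline_move 0 1) => //; apply: ltn_trans d_ge3.
Qed.

Lemma vspace_mem U : U \in S.
Proof.
rewrite -(span_basis (vbasisP U)) span_def.
by elim/big_ind: _ => // [|u _]; rewrite ?vspace0_mem ?vline_mem.
Qed.

End Frame.

(** * The four basic subspaces, the graph subspaces and what they yield *)

Section Generators.
Variables (F : fieldType) (V : vectType F).
Local Notation d := (\dim {:V}).
Local Notation e := (@bvec F V).
Local Notation co := (@bcoord F V).
Implicit Types (x : V) (P Q : pred nat) (W : {vspace V}).

Definition coordv P : {vspace V} := (\sum_(i < d | P i) <[e i]>)%VS.

Definition parityv (b : bool) := coordv (fun i => odd i == b).

Definition zigzagv (b : bool) : {vspace V} :=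
  (\sum_(i < d | (odd i == b) && (i.+1 < d)%N) pline V i i.+1 1)%VS.

Definition coefv (M : nat -> nat -> F) : {vspace V} :=
  (\sum_(i < d | ~~ odd i) <[e i - \sum_(j < d | odd j) M i j *: e j]>)%VS.

Lemma bcoord_ge i x : (d <= i)%N -> co i x = 0.
Proof. by move=> di; rewrite /bcoord insubF ?ltnNge ?di // zero_lfunE. Qed.

Lemma coordvP P x :
  reflect (forall i, (i < d)%N -> ~~ P i -> co i x = 0) (x \in coordv P).
Proof.
apply: (iffP idP) => [xP i id nPi|x0].
  apply/eqP; rewrite -memv_ker; apply: subvP x xP; apply/subv_sumP => j Pj.
  rewrite -memvE memv_ker bcoord_neq //.
  by apply: contraNneq nPi => ->.
rewrite (bcoord_sum x); apply: rpred_sum => i _.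
have [Pi|nPi] := boolP (P i); last by rewrite x0 // scale0r mem0v.
by rewrite memvZ // memvE (sumv_sup i).
Qed.

Lemma bvec_coordv P i : (i < d)%N -> P i -> e i \in coordv P.
Proof.
move=> id Pi; apply/coordvP => j jd nPj; apply: bcoord_neq.
by apply: contraNneq nPj => ->.
Qed.

Lemma capv_coordv P Q : (coordv P :&: coordv Q)%VS = coordv (predI P Q).
Proof.
apply/vspaceP => x; rewrite memv_cap.
apply/andP/coordvP => [[/coordvP xP /coordvP xQ] i id|xPQ].
  by rewrite negb_and => /orP[/xP|/xQ]; apply.
by split; apply/coordvP => i id nP; apply: xPQ; rewrite //= negb_and nP ?orbT.
Qed.

Lemma coordv1 k : (k < d)%N -> coordv (pred1 k) = <[e k]>%VS.
Proof. by move=> kd; rewrite /coordv (big_pred1 (Ordinal kd)). Qed.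

Lemma eq_coordv P Q : P =1 Q -> coordv P = coordv Q.
Proof. by move=> PQ; apply: eq_bigl => i; rewrite PQ. Qed.

(** An equation [x_i + x_j = 0] on [W] kills [x_i] on the meet when [j] is outside [P] or past the
    dimension, where [x_j] vanishes. *)
Lemma cap_coordv P Q W :
    (forall i, (i < d)%N -> Q i -> P i && (e i \in W)) ->
    (forall i, (i < d)%N -> P i -> ~~ Q i -> exists2 j, (d <= j)%N || ~~ P j &
       (W <= lker (co i + co j)%R)%VS) ->
  (W :&: coordv P)%VS = coordv Q.
Proof.
move=> QP PW; apply/eqP; rewrite eqEsubv; apply/andP; split.
  apply/subvP => x /[!memv_cap] /andP[xW /coordvP xP].
  apply/coordvP => i id nQi.
  have [Pi|/xP->//] := boolP (P i).
  have [j jP /subvP/(_ x xW)] := PW i id Pi nQi.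
  rewrite memv_ker add_lfunE.
  have [dj|jd] := leqP d j; first by rewrite (bcoord_ge _ dj) addr0 => /eqP.
  by rewrite leqNgt jd in jP; rewrite (xP j) // addr0 => /eqP.
apply/subv_sumP => i Qi; have /andP[Pi iW] := QP i (ltn_ord i) Qi.
by rewrite -memvE memv_cap iW bvec_coordv.
Qed.

(** Edges whose starting points have the same parity are disjoint, so each edge imposes its own
    equation. *)
Lemma zigzagv_lker b i :
  odd i == b -> (zigzagv b <= lker (co i + co i.+1)%R)%VS.
Proof.
move=> ib; apply/subv_sumP => j /andP[jb jd].
rewrite -memvE memv_ker add_lfunE scale1r !bcoordB !bcoord_bvec eqSS.
have -> : (i == j.+1) = false by lia.
have -> : (i.+1 == j) = false by lia.
have [ij|_] := eqVneq i j; rewrite ?ij ?jd ?ltn_ord /= !(subr0, sub0r).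
  by rewrite subrr.
by rewrite ?oppr0 addr0.
Qed.

Lemma zigzagv_mem i : (i.+1 < d)%N -> e i - e i.+1 \in zigzagv (odd i).
Proof.
move=> id; rewrite memvE -[e i.+1]scale1r.
by rewrite (sumv_sup (Ordinal (ltnW id))) //= eqxx.
Qed.

Definition belowv k := coordv (fun i => (odd i == odd k) && (i <= k)%N).
Definition abovev k := coordv (fun i => (odd i == odd k) && (k <= i)%N).

(** Adding the edges from [i] to [i.+1] shifts each axis of [belowv k.+1] one step down; an axis
    [i > k] is excluded because [x_i + x_(i+1) = 0] still holds on the sum. *)
Lemma belowvS k : (k.+1 < d)%N ->
  ((belowv k.+1 + zigzagv (odd k)) :&: parityv (odd k))%VS = belowv k.
Proof.
move=> kd; apply: cap_coordv => [i id /andP[oik ik]|i id ik]; last first.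
  rewrite ik -ltnNge => ki; exists i.+1; first by apply/orP; right; lia.
  rewrite subv_add zigzagv_lker // andbT; apply/subv_sumP => j jk.
  by rewrite -memvE memv_ker add_lfunE !bcoord_neq ?addr0 //; lia.
rewrite oik -[e i](subrK (e i.+1)) addrC memv_add ?bvec_coordv //; try lia.
have -> : odd k = odd i by lia.
by apply: zigzagv_mem; lia.
Qed.

Lemma abovevS k : (k.+1 < d)%N ->
  ((abovev k + zigzagv (odd k)) :&: parityv (odd k.+1))%VS = abovev k.+1.
Proof.
move=> kd; apply: cap_coordv => [i id /andP[oik ki]|i id ik].
  rewrite oik; case: i => // i in id ki oik *; rewrite -[e i.+1](subKr (e i)).
  rewrite memv_add ?bvec_coordv // ?memvN; try lia.
  have -> : odd k = odd i by lia.
  by apply: zigzagv_mem; lia.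
rewrite ik -ltnNge ltnS => ki; case: i => [|i] in id ik ki *.
  (* Here [k] is odd, so no edge touches [e 0]; the index [d] contributes a zero coordinate. *)
  exists d; first by rewrite leqnn.
  rewrite subv_add; apply/andP; split; apply/subv_sumP => j jk;
    rewrite -memvE memv_ker add_lfunE ?scale1r ?bcoordB !bcoord_neq ?subr0
      ?addr0 //; have := ltn_ord j; lia.
exists i; first by apply/orP; right; lia.
rewrite addrC subv_add zigzagv_lker ?andbT; last by lia.
apply/subv_sumP => j jk.
by rewrite -memvE memv_ker add_lfunE !bcoord_neq ?addr0 //; lia.
Qed.

Lemma bcoord_lincomb P (c : nat -> F) k : (k < d)%N ->
  co k (\sum_(j < d | P j) c j *: e j) = if P k then c k else 0.
Proof.
move=> kd; rewrite linear_sum /=.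
have [Pk|nPk] := ifPn; last first.
  rewrite big1 // => j Pj; rewrite bcoordZ bcoord_neq ?mulr0 //.
  by apply: contraNneq nPk => ->.
rewrite (bigD1 (Ordinal kd)) //= bcoordZ bcoord_eq // mulr1 big1 ?addr0 //.
move=> j /andP[_ jk]; rewrite bcoordZ bcoord_neq ?mulr0 //.
by rewrite eq_sym.
Qed.

(** The [j]-th equation of the graph does not involve the other odd coordinates, so it survives
    adding their axes. *)
Lemma coefv_lker M j : (j < d)%N -> odd j ->
  (coefv M + coordv (fun k => odd k && (k != j)) <=
  lker (co j + \sum_(i < d | ~~ odd i) M i j *: co i)%R)%VS.
Proof.
move=> jd oj; rewrite subv_add; apply/andP; split; apply/subv_sumP => i Pi;
  rewrite -memvE memv_ker add_lfunE sum_lfunE; last first.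
  rewrite big1 ?addr0 => [|k ok];
    by rewrite ?scale_lfunE bcoord_neq ?scaler0 //; lia.
rewrite [X in _ + X](bigD1 i) //= [X in _ + (_ + X)]big1; last first.
  move=> k /andP[ok ki]; rewrite scale_lfunE bcoordB bcoord_lincomb //.
  by rewrite (negPf ok) bcoord_neq // subr0 scaler0.
rewrite scale_lfunE !bcoordB !bcoord_lincomb // oj (negPf Pi) bcoord_eq //.
rewrite bcoord_neq; last by lia.
by rewrite subr0 sub0r addr0 /GRing.scale /= mulr1 addNr.
Qed.

Section Sublattice.
Variable S : {pred {vspace V}}.
Hypotheses
  (capS : {in S &, forall U W, (U :&: W)%VS \in S})
  (addS : {in S &, forall U W, (U + W)%VS \in S})
  (parityS : forall b, parityv b \in S) (zigzagS : forall b, zigzagv b \in S).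

Lemma belowv_mem k : (k < d)%N -> belowv k \in S.
Proof.
suff H n : forall k, (n + k.+1 = d)%N -> belowv k \in S.
  by move=> kd; apply: (H (d - k.+1)%N); lia.
elim: n => [|n IHn] {}k nk.
  have <- : parityv (odd k) = belowv k; last by [].
  rewrite /belowv /parityv /coordv; apply: eq_bigl => i.
  by have := ltn_ord i; lia.
rewrite -belowvS; last by lia.
by rewrite capS ?addS ?IHn //; lia.
Qed.

Lemma abovev_mem k : (k < d)%N -> abovev k \in S.
Proof.
elim: k => [_|k IHk kd].
  have <- : parityv false = abovev 0; last by [].
  by apply: eq_coordv => i; rewrite andbT.
by rewrite -abovevS // capS ?addS ?IHk // ltnW.
Qed.

Lemma bvec_mem k : (k < d)%N -> <[e k]>%VS \in S.
Proof.
move=> kd; have -> : <[e k]>%VS = (belowv k :&: abovev k)%VS.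
  by rewrite capv_coordv -coordv1 //; apply: eq_coordv => i /=; lia.
by rewrite capS ?abovev_mem ?belowv_mem.
Qed.

(** The plane of two consecutive axes meets the zigzag in exactly their edge. *)
Lemma pline_succ_mem k : (k.+1 < d)%N -> pline V k k.+1 1 \in S.
Proof.
move=> kd; apply: (line_mem capS addS (zigzagv_lker (eqxx (odd k)))
  (a := e k.+1) (s := 1)) => //.
- by rewrite add_lfunE bcoord_neq ?bcoord_eq ?add0r ?oner_neq0 //; lia.
- by rewrite scale1r zigzagv_mem.
- exact: bvec_mem.
- by rewrite subrK bvec_mem // ltnW.
Qed.

Hypothesis d_ge3 : (2 < d)%N.

Lemma coordv_mem P : coordv P \in S.
Proof.
rewrite /coordv; elim/big_ind: _ => [|//|k _]; last exact: bvec_mem.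
exact: vspace0_mem capS d_ge3 bvec_mem.
Qed.

(* Adding to the graph of [M] all odd axes but the [j]-th projects it onto    *)
(* its [j]-th coordinate.                                                     *)
Lemma coefv_mem M i j : (i < d)%N -> (j < d)%N -> ~~ odd i -> odd j ->
  coefv M \in S -> pline V i j (M i j) \in S.
Proof.
move=> id jd oi oj MS.
apply: (line_mem capS addS (coefv_lker M jd oj) (a := e j) (s := M i j)).
- rewrite add_lfunE sum_lfunE bcoord_eq // big1 ?addr0 ?oner_neq0 // => k ok.
  by rewrite scale_lfunE bcoord_neq ?scaler0 //; lia.
- have -> : e i - M i j *: e j = (e i - \sum_(k < d | odd k) M i k *: e k) +
      \sum_(k < d | odd k && (k != j :> nat)) M i k *: e k.
    rewrite [in RHS](bigD1 (Ordinal jd)) //= opprD addrA subrK.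
    by [].
  apply: memv_add.
    by rewrite memvE (sumv_sup (Ordinal id)).
  by apply: rpred_sum => k kj; rewrite memvZ // bvec_coordv.
- exact: bvec_mem.
- by rewrite subrK bvec_mem.
by rewrite addS ?coordv_mem.
Qed.

End Sublattice.
End Generators.

(** * Endomorphisms stabilizing three given subspaces *)

Section Stabilizer.
Variables (F : fieldType) (V : vectType F).
Implicit Types (A B C : {vspace V}) (f : 'End(V)).

Lemma dim_hom (U W : vectType F) :
  \dim {:'Hom(U, W)} = (\dim {:U} * \dim {:W})%N.
Proof. by rewrite !dimvf. Qed.

(** The map from [A] to [V / A] induced by [f], with the complement standing for the quotient; its
    vanishing means that [f] stabilizes [A]. *)
Definition compress A (f : 'End(V)) : 'Hom(subvs_of A, subvs_of A^C) :=
  (linfun (vsproj A^C) \o (\1 - projv A) \o f \o linfun vsval)%VF.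

Lemma compress_is_linear A : linear (compress A).
Proof.
move=> k f g; rewrite /compress.
by rewrite comp_lfunDr comp_lfunDl -comp_lfunZr -comp_lfunZl.
Qed.

Lemma compress_ker A f : compress A f = 0 -> (f @: A <= A)%VS.
Proof.
move=> f0; apply/subvP => _ /memv_imgP[a aA ->].
have /(congr1 vsval) : compress A f (vsproj A a) = 0 by rewrite f0 zero_lfunE.
have pA := memv_projC A (f a).
rewrite !comp_lfunE !lfunE /= id_lfunE opp_lfunE vsprojK // vsprojK //.
by move=> /eqP; rewrite subr_eq0 => /eqP->; exact: memv_proj.
Qed.

Lemma stable_vspace A : exists K : {vspace 'End(V)},
  {in K, forall f, (f @: A <= A)%VS} /\
  (\dim {:V} * \dim {:V} <= \dim K + \dim A * (\dim {:V} - \dim A))%N.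
Proof.
pose cA : {linear 'End(V) -> 'Hom(subvs_of A, subvs_of A^C)} :=
  HB.pack (compress A) (GRing.isLinear.Build _ _ _ _ _ (compress_is_linear A)).
exists (lker (linfun cA)); split.
  by move=> f; rewrite memv_ker lfunE => /eqP; exact: compress_ker.
rewrite -dim_hom -(limg_ker_dim (linfun cA)) capfv leq_add2l.
apply: leq_trans (dimvS (subvf _)) _; rewrite dim_hom -dimv_compl.
by rewrite !dimvf.
Qed.

(** For independent [v] and [w], the eigenvalue at [v + w] must agree with those at [v] and at
    [w]. *)
Lemma scalar_lfun f : (forall v, f v \in <[v]>%VS) -> f \in <[\1%VF]>%VS.
Proof.
move=> fl; have [V0|] := eqVneq {:V}%VS 0%VS.
  suff -> : f = 0 by rewrite mem0v.
  apply/lfunP => v; have : v \in {:V}%VS by rewrite memvf.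
  by rewrite V0 memv0 => /eqP->; rewrite !linear0.
rewrite -vpick0; set v := vpick _ => v0.
have /vlineP[c fv] := fl v; apply/vlineP; exists c; apply/lfunP => w.
rewrite scale_lfunE id_lfunE.
have [/vlineP[k ->]|nw] := boolP (w \in <[v]>%VS).
  by rewrite linearZ /= fv !scalerA mulrC.
have /vlineP[b fw] := fl w; have /vlineP[a] := fl (v + w).
rewrite linearD /= fv fw scalerDr => /eqP.
rewrite -subr_eq0 opprD addrACA -!scalerBl.
rewrite addr_eq0 -scaleNr opprB => /eqP vw.
have ab : a = b.
  apply: contraNeq nw => ab; apply/vlineP; exists ((a - b)^-1 * (c - a)).
  by rewrite -scalerA vw scalerK // subr_eq0.
move: vw; rewrite ab subrr scale0r => /eqP.
by rewrite scaler_eq0 (negPf v0) orbF subr_eq0 => /eqP->.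
Qed.

Lemma common_stable A B C : (2 < \dim {:V})%N ->
  exists f, [/\ (f @: A <= A)%VS, (f @: B <= B)%VS, (f @: C <= C)%VS &
    exists v, f v \notin <[v]>%VS].
Proof.
move=> d3; have [K [KA dA]] := stable_vspace A.
have [L [LB dB]] := stable_vspace B; have [M [MC dC]] := stable_vspace C.
have [f fK f1] : exists2 f, f \in (K :&: L :&: M)%VS & f \notin <[\1%VF]>%VS.
  (* Otherwise the common stabilizer has dimension at most 1, whereas each of the three codimensions
     is at most a quarter of the square of [\dim {:V}], which is at least 9. *)
  apply/subvPn; apply: contraTN isT => /dimvS.
  rewrite dim_vline => /leq_trans/(_ (leq_b1 _)).
  have := dimv_sum_cap K L; have := dimv_sum_cap (K :&: L) M.
  have := dimvS (subvf (K + L)); have := dimvS (subvf (K :&: L + M)).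
  rewrite dim_hom => ? ? ? ? ?.
  have quarter (U : {vspace V}) :
      (4 * (\dim U * (\dim {:V} - \dim U)) <= \dim {:V} * \dim {:V})%N.
    have [+ _] := nat_AGM2 (\dim U) (\dim {:V} - \dim U).
    by rewrite subnKC; last exact: dimvS (subvf _).
  have := leq_mul d3 d3; move: (quarter A) (quarter B) (quarter C) dA dB dC.
  lia.
move: fK; rewrite !memv_cap -andbA => /and3P[fK fL fM].
exists f; split; [exact: KA|exact: LB|exact: MC|].
apply: contrapT => nv; move/negP: f1; apply; apply: scalar_lfun => v.
by apply: contraT => fv; case: nv; exists v.
Qed.
End Stabilizer.

(** * Cardinal comparison by injections *)

Lemma cardinal_leP (c c' : Type) :
  cardinal_le c c' <-> exists g : c -> c', injective g.
Proof.
split=> [/card_leP[f]|[g gI]].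
  exists (fun x => val (f (to_setT x))) => x y /val_inj fxy.
  by have /(congr1 val) := 'inj_f (mem_set I) (mem_set I) fxy.
have : $|{injfun [set: c] >-> [set: c']}|.
  by apply/injfunPex; exists g => // x y _ _; exact: gI.
by move=> [k]; exact: inj_card_le.
Qed.

Lemma cardinal_ge4 (T : Type) (X : set T) : T ->
    (forall a b c, exists x, [/\ X x, x <> a, x <> b & x <> c]) ->
  cardinal_le 'I_4 (set_type X).
Proof.
move=> t ex; have [a [Xa _ _ _]] := ex t t t; have [b [Xb ba _ _]] := ex a a a.
have [c [Xc ca cb _]] := ex a b b; have [d [Xd da db dc]] := ex a b c.
apply/cardinal_leP.
pose x0 : X := SigSub (mem_set Xa).
exists (nth x0 [:: x0; SigSub (mem_set Xb); SigSub (mem_set Xc);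
                   SigSub (mem_set Xd)]).
move=> [[|[|[|[|//]]]] ?] [[|[|[|[|//]]]] ?] /= /(congr1 val) /= eq_ab;
  by apply/val_inj => //=; exfalso; congruence.
Qed.

(** * Generating sets of the subspace lattice *)

Section Generation.
Variables (F : fieldType) (V : vectType F).
Hypothesis d_ge3 : (2 < \dim {:V})%N.

Lemma no_three_generators (A B C : SubV V) (X : set (SubV V)) :
    generates_lattice X -> exists x, [/\ X x, x <> A, x <> B & x <> C].
Proof.
move=> genX; have [f [fA fB fC [v fv]]] := @common_stable F V A B C d_ge3.
apply: contrapT => nX.
have := genX [pred U | (f @: U <= U)%VS] _ _ _ <[v]>%VS.
rewrite !inE /= limg_line -memvE (negPf fv) => H; suff: false = true by [].
apply: H => [U W|U W|U XU]; rewrite ?inE.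
- by move=> fU fW; exact: subv_trans (limg_cap _ _ _) (capvS fU fW).
- by move=> fU fW; rewrite limgD addvS.
by apply: contrapT => nU; apply: nX; exists U; split=> [|UA|UB|UC];
  [exact/set_mem|..]; apply: nU; rewrite ?UA ?UB ?UC.
Qed.

(** Indices 0 and 1 give the two parity spans, 2 and 3 the two zigzags. Indexing by ['I_4 + m]
    bounds the size of the range even if subspaces coincide. *)
Definition generators (m : Type) (M : m -> nat -> nat -> F) (k : 'I_4 + m) :
    SubV V :=
  match k with
  | inl i => if (i < 2)%N then parityv V (odd i) else zigzagv V (odd i)
  | inr mu => coefv V (M mu)
  end.

Lemma generators_generate (X : set F) (m : Type) (M : m -> nat -> nat -> F) :
    generates_field X ->
    (forall x, X x -> exists mu i j, [/\ (i < \dim {:V})%N, (j < \dim {:V})%N,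
      ~~ odd i, odd j & M mu i j = x]) ->
  generates_lattice (range (generators M)).
Proof.
move=> genX XM S capS addS genS.
have genM k : generators M k \in S by apply: genS; apply/mem_set; exists k.
have parityS b : parityv V b \in S.
  by have := genM (inl (inord b)); rewrite /= inordK; case: b.
have zigzagS b : zigzagv V b \in S.
  by have := genM (inl (inord (2 + b))); rewrite /= inordK; case: b.
have capS' : {in S &, forall U W : {vspace V}, (U :&: W)%VS \in S}.
  exact: capS.
have addS' : {in S &, forall U W : {vspace V}, (U + W)%VS \in S}.
  exact: addS.
have eS := bvec_mem capS' addS' parityS zigzagS.
have succS := pline_succ_mem capS' addS' parityS zigzagS.
suff coefS c : pline V 0 1 c \in S.
  by move=> U; rewrite (vspace_mem capS' addS' d_ge3 eS succS coefS).
have := genX _ (coefs_divring_closed capS' addS' d_ge3 eS succS) _ c.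
rewrite inE; apply=> x /set_mem /XM [mu [i [j [id jd oi oj <-]]]]; rewrite inE.
apply: (@pline_move _ _ _ capS' addS' d_ge3 eS succS i j) => //; try lia.
exact: (coefv_mem capS' addS' parityS zigzagS d_ge3 id jd oi oj
  (genM (inr mu))).
Qed.

End Generation.

(** * Packing field generators into matrices, and the two bounds *)

Lemma cardinal_le_entries (T m : Type) (X : set T) (n : nat) :
    T -> cardinal_le (set_type X) (m * 'I_n) ->
  exists h : m -> nat -> T,
    forall x, X x -> exists mu k, (k < n)%N /\ h mu k = x.
Proof.
move=> x0 /cardinal_leP[g gI].
(* [h] inverts the injection [g] on its image and takes the default [x0] elsewhere. *)
have /choice[h hP] (p : m * nat) : exists y : T, forall x : X,
    (g x).1 = p.1 -> val (g x).2 = p.2 -> val x = y.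
  have [[x [x1 x2]]|nx] :=
    pselect (exists x, (g x).1 = p.1 /\ val (g x).2 = p.2).
    exists (val x) => y y1 y2; congr (val _); apply: gI.
    rewrite [LHS]surjective_pairing [RHS]surjective_pairing x1 y1.
    by congr (_, _); apply: val_inj; rewrite x2.
  by exists x0 => x x1 x2; case: nx; exists x.
exists (fun mu k => h (mu, k)) => x Xx.
pose y : X := SigSub (mem_set Xx).
by exists (g y).1, (val (g y).2); rewrite ltn_ord -(hP _ y).
Qed.

Lemma mng_le (T : Type) (G : set T -> Prop) (c : Type) (f : c -> T) :
  G (range f) -> cardinal_le (mng G) c.
Proof.
move=> Gf; have [_ min] := mngP (ex_intro _ _ Gf).
apply: card_le_trans (min _ (ex_intro2 _ _ _ Gf erefl)) _.
by rewrite (card_le_eql (card_setT _)); exact: card_image_le.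
Qed.

Lemma cardinal_ceil_divP (t : Type) (n : nat) : (0 < n)%N ->
  cardinal_le t (cardinal_ceil_div t n * 'I_n).
Proof.
move=> n0; pose P m := cardinal_le t (m * 'I_n).
apply: (proj1 (@cardinal_min_ex P _ _)).
  move=> c c' /cardinal_leP[g gI] _ /cardinal_leP[h hI]; apply/cardinal_leP.
  exists (fun x => (g (h x).1, (h x).2)) => x y [/gI xy1 xy2].
  by apply: hI; rewrite [LHS]surjective_pairing xy1 xy2 -surjective_pairing.
exists t; apply/cardinal_leP; exists (fun x => (x, Ordinal n0)).
by move=> x y [].
Qed.

Local Close Scope ring_scope.

Theorem theorem3p1 (F : fieldType) (d : nat) (V : vectType F)
    (d_ge3 : 3 <= d) (dimV : \dim {:V} = d) :
  cardinal_le 'I_4 (mng_lattice (SubV V)) /\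
  cardinal_le (mng_lattice (SubV V))
    ('I_4 + cardinal_ceil_div (mng_field F) (d ^ 2 %/ 4)).
Proof.
have d3 : 2 < \dim {:V} by rewrite dimV.
split.
  have [|[X genX mngE] _] := @mngP _ (@generates_lattice _ (SubV V)).
    by exists setT => S _ _ XS U; apply: XS; apply/mem_set.
  rewrite /mng_lattice mngE; apply: (cardinal_ge4 0%VS) => A B C.
  exact: no_three_generators.
have [|[X genX mngE] _] := @mngP _ (@generates_field F).
  by exists setT => S _ XS U; apply: XS; apply/mem_set.
have n0 : 0 < d ^ 2 %/ 4 by rewrite divn_gt0 //; nia.
have := cardinal_ceil_divP (mng_field F) n0.
set m := cardinal_ceil_div _ _; rewrite {1}/mng_field mngE.
move=> /(@cardinal_le_entries F _ X _ 0%R)[h hX].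
(* There are [uphalf d] even and [d./2] odd indices below [d], and their product is [d ^ 2 %/ 4];
   the entries are numbered row by row, so that division by [d./2] recovers the row and column. *)
apply: (@mng_le _ _ _ (generators V (fun mu i j => h mu (i./2 * d./2 + j./2)))).
apply: (generators_generate d3 genX) => x /hX[mu [k [kn <-]]].
have dE : d ^ 2 %/ 4 = d./2 * uphalf d.
  rewrite -[d in d ^ 2]odd_double_half uphalf_half; case: (odd d) => /=; nia.
have h0 : 0 < d./2 by lia.
have kdiv : k %/ d./2 < uphalf d by rewrite ltn_divLR // mulnC -dE.
have kmod := ltn_pmod k h0.
exists mu, (k %/ d./2).*2, (k %% d./2).*2.+1; rewrite dimV; split; try lia.
by rewrite doubleK /= uphalf_double -divn_eq.
Qed.
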